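(* Let $(n,w)$ be an $(n,d,\varepsilon)$-regular instance of TSP. Let $M^*$ be an optimal matching of $K_n$ of minimum weight, and let $H^*$ be any Hamilton cycle of $K_n$ with $$w(H^* )\le\Big(1-\frac1{n-2}\Big)w(M^* )+\frac1{n-2}w(K_n)+\rho(n),$$ where $\rho(n)=1$ if $n$ is odd and $0$ if $n$ is even. Then for a uniformly random Hamilton cycle $H$ of $K_n$, $\mathbb{P}(w(H)\le w(H^* ))\le 2n^{-\varepsilon}$; in particular the algorithm outputting such $H^*$ has domination ratio at least $1-2n^{-\varepsilon}$ for $(n,w)$.
   Context: $K_n=(V_n,E_n)$ is the complete graph on $n$ vertices; $w(G)=\sum_{e\in E(G)}w(e)$; a $\{0,1\}$-instance has $w:E_n\to\{0,1\}$. An optimal matching of $K_n$ is any set of $\lfloor n/2\rfloor$ pairwise disjoint edges. For $d\in[0,1]$, $\varepsilon>0$ and integer $n>\max\{6,\exp(\varepsilon^{-1})\}$, a $\{0,1\}$-instance $(n,w)$ is $(n,d,\varepsilon)$-regular if (i) $w(K_n)=d\binom n2$, and (ii) there is an optimal matching $M$ of $K_n$ with either $w(M)\le\frac12dn-m_\varepsilon(n,d)$ or $w(M)\le\frac12dn-m_\varepsilon(n,1-d)$, where $m_\varepsilon(n,d):=40(\varepsilon+\varepsilon^{1/2})\log n+40\varepsilon^{1/2}d^{1/4}\sqrt{n\log n}$. *)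

(* Defs.v *)
From Stdlib Require Import Reals.
From mathcomp Require Import all_boot fingroup perm.
Set Implicit Arguments. Unset Strict Implicit. Unset Printing Implicit Defensive.

Definition edges_Kn (n : nat) : {set {set 'I_n}} :=
  [set e : {set 'I_n} | #|e| == 2%N].

(* A {0,1}-instance: w : {set 'I_n} -> bool (only its values on edges matter);
   the weight of a set G of edges is w(G) = sum_{e in G} w(e). *)
Definition wt (n : nat) (w : {set 'I_n} -> bool) (G : {set {set 'I_n}}) : nat :=
  (\sum_(e in G) (w e : nat))%N.

Definition optimal_matching (n : nat) (M : {set {set 'I_n}}) : Prop :=
  M \subset edges_Kn n /\ #|M| = n./2 /\
  (forall e f, e \in M -> f \in M -> e != f -> [disjoint e & f]).

Definition is_ham_cycle (n : nat) (H : {set {set 'I_n}}) : bool :=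
  [exists s : {perm 'I_n}, H == [set [set s i; s (ordS i)] | i : 'I_n]].

Definition ham_cycles (n : nat) : {set {set {set 'I_n}}} :=
  [set H | is_ham_cycle H].

Open Scope R_scope.

Definition m_eps (eps : R) (n : nat) (d : R) : R :=
  40 * (eps + sqrt eps) * ln (INR n)
  + 40 * sqrt eps * sqrt (sqrt d) * sqrt (INR n * ln (INR n)).

Definition regular_instance (n : nat) (d eps : R) (w : {set 'I_n} -> bool) : Prop :=
  0 <= d <= 1 /\ 0 < eps /\ 6 < INR n /\ exp (/ eps) < INR n /\
  INR (wt w (edges_Kn n)) = d * INR ('C(n, 2)) /\
  exists M : {set {set 'I_n}}, optimal_matching M /\
    (INR (wt w M) <= / 2 * d * INR n - m_eps eps n d \/
     INR (wt w M) <= / 2 * d * INR n - m_eps eps n (1 - d)).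

Definition rho (n : nat) : R := if odd n then 1 else 0.

(* Main.v *)
(** The average weight of a Hamilton cycle is [d n], so the hypotheses put
    [wt w Hstar] at least [31/40 m_eps] below the average, and it remains to bound
    a tail of [X s], the weight of the cycle traced by a uniform permutation [s].
    Stein's method of exchangeable pairs applies to switchings of two positions of
    [s]: summed over all pairs of positions, the change of [X] is exactly a
    negative multiple of [X - d n], and its square is [O(n (X + d n))].  Hence the
    moment generating function of [X - d n] is at most [exp (12 d n theta^2)] for
    [theta <= 1/12], and Chernoff's bound gives a lower tail governed by [d].  For
    [m_eps] taken at [1 - d], the upper tail of the complementary weight is used. *)

Require Import Defs.
From Stdlib Require Import Reals Lra.
From HB Require Import structures.
From mathcomp Require Import all_boot fingroup perm.
Set Implicit Arguments. Unset Strict Implicit. Unset Printing Implicit Defensive.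
Open Scope R_scope.

(** * Finite sums of real numbers *)

HB.instance Definition _ := Monoid.isComLaw.Build R 0 Rplus
  (fun x y z => esym (Rplus_assoc x y z)) Rplus_comm Rplus_0_l.
HB.instance Definition _ := Monoid.isMulLaw.Build R 0 Rmult Rmult_0_l Rmult_0_r.
HB.instance Definition _ := Monoid.isAddLaw.Build R Rmult Rplus
  Rmult_plus_distr_r Rmult_plus_distr_l.

Notation "\rsum_ i F" := (\big[Rplus/0]_i F)
  (at level 36, F at level 36, i at level 0, format "\rsum_ i  F") : R_scope.

Section RealSums.
Variable I : finType.
Implicit Types f g : I -> R.

Lemma rsumD f g : \rsum_i (f i + g i) = \rsum_i f i + \rsum_i g i.
Proof. exact: big_split. Qed.

Lemma rsumZ c f : \rsum_i (c * f i) = c * \rsum_i f i.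
Proof. by rewrite big_distrr. Qed.

Lemma rsumB f g : \rsum_i (f i - g i) = \rsum_i f i - \rsum_i g i.
Proof.
rewrite (eq_bigr (fun i => f i + -1 * g i)); last by move=> i _; ring.
by rewrite rsumD rsumZ; ring.
Qed.

Lemma rsum_le f g : (forall i, f i <= g i) -> \rsum_i f i <= \rsum_i g i.
Proof.
by move=> le_fg; elim/big_ind2: _ => //; [lra | move=> *; apply: Rplus_le_compat].
Qed.

Lemma rsum_ge0 f : (forall i, 0 <= f i) -> 0 <= \rsum_i f i.
Proof. by move=> f_ge0; elim/big_ind: _ => //; [lra | move=> *; lra]. Qed.

Lemma rsum_abs f : Rabs (\rsum_i f i) <= \rsum_i Rabs (f i).
Proof.
apply: (big_ind2 (fun x y => Rabs x <= y)) => [|x1 y1 x2 y2 ? ?|i _].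
- by rewrite Rabs_R0; lra.
- by have := Rabs_triang x1 x2; lra.
- exact: Rle_refl.
Qed.

Lemma rsum_const c : \big[Rplus/0]_(i : I) c = INR #|I| * c.
Proof.
rewrite big_const; elim: #|I| => [|m IHm]; first by rewrite /=; ring.
by rewrite iterS IHm S_INR; ring.
Qed.

Lemma INR_sum (P : pred I) (f : I -> nat) :
  INR (\sum_(i | P i) f i)%N = \big[Rplus/0]_(i | P i) INR (f i).
Proof.
by elim/big_ind2: _ => // x1 y1 x2 y2 <- <-; rewrite plus_INR.
Qed.

Lemma derivable_rsum (f : I -> R -> R) (df : I -> R) x :
  (forall i, derivable_pt_lim (f i) x (df i)) ->
  derivable_pt_lim (fun u => \rsum_i f i u) x (\rsum_i df i).
Proof.
move=> Hf; elim: (index_enum I) => [|i r IHr].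
  apply: (derivable_pt_lim_ext (fct_cte 0)); first by move=> u; rewrite big_nil.
  by rewrite big_nil; apply: derivable_pt_lim_const.
apply: (derivable_pt_lim_ext (f i + (fun u => \big[Rplus/0]_(j <- r) f j u))%F).
  by move=> u; rewrite big_cons.
by rewrite big_cons; apply: derivable_pt_lim_plus.
Qed.

Definition kron (i j : I) : R := if i == j then 1 else 0.

Lemma rsum_kron k f : \rsum_i (kron i k * f i) = f k.
Proof.
rewrite (bigD1 k) //= big1 => [|i /negbTE ne_ik]; rewrite /kron ?eqxx ?ne_ik; ring.
Qed.

End RealSums.

(** * Effect on the cycle weight of exchanging two positions *)

Section Switching.
Variables (n : nat) (a : 'I_n -> 'I_n -> R).
Hypothesis n_gt6 : (6 < n)%N.
Hypothesis a_sym : forall x y, a x y = a y x.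
Hypothesis a_diag : forall x, a x x = 0.
Hypothesis a01 : forall x y, 0 <= a x y <= 1.

Definition cycle_weight (s : {perm 'I_n}) : R := \rsum_k a (s k) (s (ordS k)).
(** The sum runs over ordered pairs, so each edge counts twice. *)
Definition total_weight : R := \rsum_x \rsum_y a x y.
(** The left factor of a product acts first, so two positions are exchanged, not two vertices.
    Diagonal pairs give the identity switch. *)
Definition switch (p : 'I_n * 'I_n) (s : {perm 'I_n}) : {perm 'I_n} :=
  (tperm p.1 p.2 * s)%g.

Lemma switchK p : involutive (switch p).
Proof. by move=> s; rewrite /switch mulgA tperm2 mul1g. Qed.

Lemma ordS_neq (k : 'I_n) : k != ordS k.
Proof.
apply/eqP => /(congr1 val) /=.
have [ltSk|leSk] := ltnP k.+1 n.
  by rewrite modn_small // => /eqP; rewrite ltn_eqF.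
have -> : k.+1 = n by apply/eqP; rewrite eqn_leq leSk ltn_ord.
by rewrite modnn => k0; move: leSk; rewrite k0 leqNgt (ltn_trans _ n_gt6).
Qed.

(* The number of entries of p lying in {k, k+1}; when it is 2 the switch at p
   leaves the pair of values at these positions unchanged up to order. *)
Definition touch (k : 'I_n) (p : 'I_n * 'I_n) : R :=
  kron p.1 k + kron p.1 (ordS k) + kron p.2 k + kron p.2 (ordS k).

Lemma touch_ge0 k p : 0 <= touch k p.
Proof. by rewrite /touch /kron; do 4 case: (_ == _); lra. Qed.

(** Each of the two entries of [p] lies in {k, k+1} for exactly two [k]. This caps the change of
    weight under a switch by 4. *)
Lemma sum_touch_cycle p : \rsum_k touch k p = 4.
Proof.
have sumk (i : 'I_n) : \rsum_k kron i k = 1.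
  rewrite -[RHS](rsum_kron i (fun=> 1)); apply: eq_bigr => k _.
  by rewrite /kron eq_sym; case: (_ == _); ring.
have sumSk (i : 'I_n) : \rsum_k kron i (ordS k) = 1.
  by rewrite -(sumk i) [RHS](reindex_inj (@ordS_inj n)).
by rewrite !rsumD !sumk !sumSk; ring.
Qed.

(** The difference vanishes unless [touch k p] is 1: at 0 nothing moves, and at 2 the switch is the
    identity or reverses the pair, which [a_sym] ignores. With the factor inserted, new and old
    weights can be summed separately. *)
Lemma switch_touch k p (s : {perm 'I_n}) :
  a (switch p s k) (switch p s (ordS k)) - a (s k) (s (ordS k)) =
  touch k p * (a (switch p s k) (switch p s (ordS k)) - a (s k) (s (ordS k))).
Proof.
case: p => i j; rewrite /touch /kron /switch !permM /=.
set l := ordS k; have ne_kl : k != l := ordS_neq k.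
have [->|ne_ik] := eqVneq i k; have [->|ne_jk] := eqVneq j k;
  have [?|ne_il] := eqVneq i l; have [?|ne_jl] := eqVneq j l; subst;
  rewrite ?tperm1 ?perm1 ?tpermL ?tpermR ?eqxx ?(negbTE ne_kl)
    ?(eq_sym _ k) ?(negbTE ne_kl); try ring.
all: try by move: ne_kl; rewrite ?eqxx.
all: try by rewrite a_sym; ring.
by rewrite !tpermD //; ring.
Qed.

(** Only [j = l] deviates from [b j l]: there the pair is reversed and contributes [b l k] in place
    of [b l l = 0]. *)
Lemma sum_switch_left (b : 'I_n -> 'I_n -> R) k l :
  (forall x y, b x y = b y x) -> (forall x, b x x = 0) -> k != l ->
  \rsum_j b (tperm k j k) (tperm k j l) = \rsum_j b j l + b k l.
Proof.
move=> b_sym b_diag ne_kl.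
rewrite -[b k l in RHS](rsum_kron l (fun=> b k l)) -rsumD.
apply: eq_bigr => j _; rewrite tpermL /kron.
have [->|ne_jl] := eqVneq j l; first by rewrite tpermR b_diag (b_sym l k); ring.
by rewrite tpermD //; ring.
Qed.

(** Each of the four Kronecker terms of [touch] fixes one coordinate, and by symmetry fixing the
    first or the second gives the same sum. *)
Lemma sum_touch k (F : 'I_n -> 'I_n -> R) :
  (forall i j, F i j = F j i) ->
  \rsum_p (touch k p * F p.1 p.2) = 2 * (\rsum_j F k j + \rsum_j F (ordS k) j).
Proof.
move=> F_sym; rewrite -(pair_bigA _ (fun i j => touch k (i, j) * F i j)) /=.
have half (l : 'I_n) : \rsum_i \rsum_j (kron i l * F i j) = \rsum_j F l j.
  rewrite -[RHS](rsum_kron l (fun i => \rsum_j F i j)).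
  by apply: eq_bigr => i _; rewrite rsumZ.
have half' (l : 'I_n) : \rsum_i \rsum_j (kron j l * F i j) = \rsum_j F l j.
  by apply: eq_bigr => i _; rewrite rsum_kron.
rewrite (eq_bigr (fun i =>
   \rsum_j (kron i k * F i j) + \rsum_j (kron i (ordS k) * F i j)
   + \rsum_j (kron j k * F i j) + \rsum_j (kron j (ordS k) * F i j))); last first.
  move=> i _; rewrite -!rsumD; apply: eq_bigr => j _; rewrite /touch /=; ring.
by rewrite !rsumD !half !half' /=; ring.
Qed.

Lemma sum_touch_old (s : {perm 'I_n}) :
  \rsum_k \rsum_p (touch k p * a (s k) (s (ordS k))) = 4 * INR n * cycle_weight s.
Proof.
rewrite -rsumZ; apply: eq_bigr => k _.
rewrite (sum_touch k (F := fun _ _ => a (s k) (s (ordS k)))) //.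
by rewrite !rsum_const card_ord; ring.
Qed.

(** Exchanging one end of an edge with every position yields the weighted degree of the other end,
    plus that edge once more. Along the cycle the degrees add up to [total_weight]. *)
Lemma sum_touch_new (s : {perm 'I_n}) :
  \rsum_k \rsum_p (touch k p * a (switch p s k) (switch p s (ordS k))) =
  4 * total_weight + 4 * cycle_weight s.
Proof.
(* The weighted degree of [x]. *)
pose D x := \rsum_y a y x.
have sumD (f : 'I_n -> 'I_n) : injective f ->
    \rsum_k D (s (f k)) = total_weight.
  move=> inj_f; rewrite -(reindex_inj (h := s \o f) (P := xpredT)
                                      (F := D)) /=; last exact: inj_comp perm_inj inj_f.
  by rewrite /total_weight exchange_big.
have Dperm x : \rsum_j a (s j) x = D x by rewrite /D [RHS](reindex_inj (@perm_inj _ s)).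
rewrite (eq_bigr (fun k => 2 * (D (s k) + D (s (ordS k)) + 2 * a (s k) (s (ordS k))))).
  rewrite rsumZ !rsumD rsumZ (sumD id) // (sumD (@ordS n)); last exact: ordS_inj.
  by rewrite /cycle_weight; ring.
move=> k _; set l := ordS k.
have ne_kl : k != l := ordS_neq k.
pose b x y := a (s x) (s y).
rewrite (eq_bigr (fun p => touch k p * b (tperm p.1 p.2 k) (tperm p.1 p.2 l))); last first.
  by move=> p _; rewrite /switch !permM.
rewrite (sum_touch k (F := fun i j => b (tperm i j k) (tperm i j l))); last first.
  by move=> i j; rewrite tpermC.
have b_sym x y : b x y = b y x by exact: a_sym.
have b_diag x : b x x = 0 by exact: a_diag.
have -> : \rsum_j b (tperm k j k) (tperm k j l) = D (s l) + b k l.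
  by rewrite sum_switch_left // Dperm.
have -> : \rsum_j b (tperm l j k) (tperm l j l) = D (s k) + b k l.
  rewrite b_sym -[D _]Dperm -sum_switch_left // 1?eq_sym //.
  by apply: eq_bigr => j _; apply: b_sym.
by rewrite /b; ring.
Qed.

(** This is the linear regression condition of Stein's method: the right side is a multiple of the
    deviation of the weight from [total_weight / (n - 1)]. *)
Lemma sum_switch (s : {perm 'I_n}) :
  \rsum_p (cycle_weight (switch p s) - cycle_weight s) =
  4 * (total_weight - (INR n - 1) * cycle_weight s).
Proof.
transitivity (\rsum_k \rsum_p (touch k p * a (switch p s k) (switch p s (ordS k)))
   - \rsum_k \rsum_p (touch k p * a (s k) (s (ordS k)))).
  rewrite exchange_big [in X in _ - X]exchange_big -rsumB.
  apply: eq_bigr => p _; rewrite /cycle_weight -!rsumB; apply: eq_bigr => k _.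
  by rewrite switch_touch; ring.
by rewrite sum_touch_old sum_touch_new; ring.
Qed.

(** The change [dX] satisfies both [|dX| <= 4] and [|dX| <= N], where [N] adds the old and new
    weights at touched positions; hence [dX ^ 2 <= 4 N]. Bounding by weights rather than by a
    constant makes the variance scale with the density. *)
Lemma sum_switch_sqr (s : {perm 'I_n}) :
  \rsum_p (cycle_weight (switch p s) - cycle_weight s) ^ 2 <=
  16 * (total_weight + (INR n + 1) * cycle_weight s).
Proof.
have -> : 16 * (total_weight + (INR n + 1) * cycle_weight s) =
  4 * (\rsum_k \rsum_p (touch k p * a (switch p s k) (switch p s (ordS k)))
   + \rsum_k \rsum_p (touch k p * a (s k) (s (ordS k)))).
  by rewrite sum_touch_old sum_touch_new; ring.
rewrite exchange_big [in X in _ + X]exchange_big -rsumD -rsumZ.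
apply: rsum_le => p; rewrite -rsumD.
set N := \rsum_k _; set dX := _ - _.
have dXE : dX = \rsum_k (touch k p *
    (a (switch p s k) (switch p s (ordS k)) - a (s k) (s (ordS k)))).
  by rewrite /dX /cycle_weight -rsumB; apply: eq_bigr => k _; apply: switch_touch.
have bnd c x y : 0 <= c -> 0 <= x <= 1 -> 0 <= y <= 1 ->
    Rabs (c * (x - y)) <= c /\ Rabs (c * (x - y)) <= c * x + c * y.
  move=> c0 [x0 x1] [y0 y1]; rewrite Rabs_mult (Rabs_pos_eq c) //.
  by split; [rewrite -[X in _ <= X]Rmult_1_r | rewrite -Rmult_plus_distr_l];
    apply: Rmult_le_compat_l => //; rewrite /Rabs; case: Rcase_abs; lra.
have le4 : Rabs dX <= 4.
  rewrite dXE -(sum_touch_cycle p); apply: Rle_trans (rsum_abs _) _.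
  by apply: rsum_le => k; apply: (proj1 (bnd _ _ _ _ _ _)) => //; apply: touch_ge0.
have leN : Rabs dX <= N.
  rewrite dXE; apply: Rle_trans (rsum_abs _) _.
  by apply: rsum_le => k; apply: (proj2 (bnd _ _ _ _ _ _)) => //; apply: touch_ge0.
rewrite -pow2_abs; have := Rabs_pos dX; nra.
Qed.

End Switching.

(** * Inequalities for the exponential and for quotients *)

Lemma exp_le_compat x y : x <= y -> exp x <= exp y.
Proof. by case=> [/exp_increasing|->]; lra. Qed.

Lemma le_div x y z : 0 < z -> x * z <= y -> x <= y / z.
Proof. by move=> z0 le_xz; apply: (Rmult_le_reg_r z) => //; field_simplify; lra. Qed.

(** By convexity the slope of a chord of [exp] is at most its larger end value, hence at most the
    sum of both. The form symmetric in [x] and [y] suits exchangeability. *)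
Lemma exp_diff_le x y : (y - x) * (exp y - exp x) <= (y - x) ^ 2 * (exp x + exp y).
Proof.
wlog le_xy : x y / x <= y => [IH|].
  have [/IH //|lt_yx] := Rle_or_lt x y.
  by have := IH y x (Rlt_le _ _ lt_yx); lra.
have Ey : exp x = exp y * exp (x - y) by rewrite -exp_plus; congr exp; ring.
have e1 := exp_ineq1_le (x - y); have [px py] := (exp_pos x, exp_pos y).
have : exp y - exp x <= (y - x) * exp y by rewrite Ey; nra.
move/(Rmult_le_compat_l (y - x)) => /(_ ltac:(lra)); have := pow2_ge_0 (y - x).
by rewrite /= => ? ?; nra.
Qed.

(** * Concentration around the mean [mu] of the weight traced by a uniform permutation *)

Section Concentration.
Variables (n : nat) (a : 'I_n -> 'I_n -> R) (mu : R).
Hypothesis n_gt6 : (6 < n)%N.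
Hypothesis a_sym : forall x y, a x y = a y x.
Hypothesis a_diag : forall x, a x x = 0.
Hypothesis a01 : forall x y, 0 <= a x y <= 1.
Hypothesis total_mu : total_weight a = (INR n - 1) * mu.

Local Notation X := (cycle_weight a).

Let n_ge7 : 7 <= INR n.
Proof. by have /leP/le_INR := n_gt6; rewrite /=; lra. Qed.

Lemma mean_ge0 : 0 <= mu.
Proof.
have : 0 <= total_weight a.
  by apply: rsum_ge0 => x; apply: rsum_ge0 => y; have [] := a01 x y.
by rewrite total_mu => ?; nra.
Qed.

Lemma cycle_weight_ge0 s : 0 <= X s.
Proof. by apply: rsum_ge0 => k; have [] := a01 (s k) (s (ordS k)). Qed.

(* The uniform measure is invariant under each involution [switch p]: this is
   the symmetrization step of Stein's method of exchangeable pairs. *)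
Lemma exchangeable (F : {perm 'I_n} -> {perm 'I_n} -> R) :
  \rsum_s \rsum_p F s (switch p s) = \rsum_s \rsum_p F (switch p s) s.
Proof.
rewrite exchange_big [RHS]exchange_big; apply: eq_bigr => p _.
rewrite (reindex_inj (inv_inj (switchK p))).
by apply: eq_bigr => s _; rewrite switchK.
Qed.

(** The products of the increments of [X] and of [exp (theta X)] are summed over all switches. The
    regression identity evaluates the sum exactly; [exp_diff_le] and the second moment bound it from
    above. *)
Lemma stein_bound theta :
  theta * \rsum_s ((X s - mu) * exp (theta * X s)) <=
  6 * theta ^ 2 * \rsum_s ((X s + mu) * exp (theta * X s)).
Proof.
pose g s := exp (theta * X s).
have g_gt0 s : 0 < g s by apply: exp_pos.
pose lhs := \rsum_s \rsum_p (theta * (X (switch p s) - X s) * (g (switch p s) - g s)).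
pose rhs := \rsum_s \rsum_p
  (theta ^ 2 * (X (switch p s) - X s) ^ 2 * (g s + g (switch p s))).
have le_lr : lhs <= rhs.
  apply: rsum_le => s; apply: rsum_le => p; rewrite /g.
  by have := exp_diff_le (theta * X s) (theta * X (switch p s)); lra.
have lhsE : lhs = 8 * (INR n - 1) * (theta * \rsum_s ((X s - mu) * g s)).
  (* Exchanging [s] with its switch shows that the two halves of [lhs] agree. *)
  have -> : lhs = -2 * \rsum_s \rsum_p (theta * g s * (X (switch p s) - X s)).
    have E := exchangeable (fun s t => theta * (X t - X s) * g t).
    transitivity (\rsum_s \rsum_p (theta * (X (switch p s) - X s) * g (switch p s))
      - \rsum_s \rsum_p (theta * g s * (X (switch p s) - X s))).
      rewrite -rsumB; apply: eq_bigr => s _; rewrite -rsumB.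
      by apply: eq_bigr => p _; ring.
    rewrite E.
    have -> : \rsum_s \rsum_p (theta * (X s - X (switch p s)) * g s) =
       -1 * \rsum_s \rsum_p (theta * g s * (X (switch p s) - X s)).
      rewrite -rsumZ; apply: eq_bigr => s _; rewrite -rsumZ.
      by apply: eq_bigr => p _; ring.
    by ring.
  rewrite -!rsumZ; apply: eq_bigr => s _.
  by rewrite rsumZ sum_switch // total_mu; ring.
have rhsE : rhs = \rsum_s (2 * theta ^ 2 * g s * \rsum_p (X (switch p s) - X s) ^ 2).
  have E := exchangeable (fun s t => theta ^ 2 * (X t - X s) ^ 2 * g t).
  transitivity (\rsum_s \rsum_p (theta ^ 2 * (X (switch p s) - X s) ^ 2 * g s)
      + \rsum_s \rsum_p (theta ^ 2 * (X (switch p s) - X s) ^ 2 * g (switch p s))).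
    rewrite -rsumD; apply: eq_bigr => s _; rewrite -rsumD.
    by apply: eq_bigr => p _; ring.
  rewrite E -rsumD; apply: eq_bigr => s _; rewrite -rsumD -rsumZ.
  by apply: eq_bigr => p _; ring.
have le_r : rhs <= 8 * (INR n - 1) * (6 * theta ^ 2 * \rsum_s ((X s + mu) * g s)).
  rewrite rhsE -!rsumZ; apply: rsum_le => s.
  have sq := sum_switch_sqr n_gt6 a_sym a_diag a01 s.
  have [X0 mu0] := (cycle_weight_ge0 s, mean_ge0).
  (* The constant 24 comes from [16 (n + 1) <= 24 (n - 1)], valid for [n >= 5]. *)
  have : \rsum_p (X (switch p s) - X s) ^ 2 <= 24 * (INR n - 1) * (X s + mu).
    by apply: Rle_trans sq _; rewrite total_mu; nra.
  move=> le24; apply: Rle_trans (Rmult_le_compat_l _ _ _ _ le24) _.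
    by have := g_gt0 s; have := pow2_ge_0 theta; nra.
  by right; ring.
have : 8 * (INR n - 1) * (theta * \rsum_s ((X s - mu) * g s)) <=
       8 * (INR n - 1) * (6 * theta ^ 2 * \rsum_s ((X s + mu) * g s)) by lra.
by apply: Rmult_le_reg_l; lra.
Qed.

(** Since [6 theta <= 1/2], the part of the bound containing [X - mu] is absorbed into half of the
    left side if that side is positive; otherwise the claim is trivial. Negative [theta] of any size
    is allowed. *)
Lemma stein_drift theta : theta <= / 12 ->
  theta * \rsum_s ((X s - mu) * exp (theta * X s)) <=
  24 * mu * theta ^ 2 * \rsum_s exp (theta * X s).
Proof.
move=> le12; have := stein_bound theta.
have -> : \rsum_s ((X s + mu) * exp (theta * X s)) =
  \rsum_s ((X s - mu) * exp (theta * X s))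
  + 2 * mu * \rsum_s exp (theta * X s).
  by rewrite -rsumZ -rsumD; apply: eq_bigr => s _; ring.
set A := \rsum_s _; set Phi := \rsum_s _ => bnd.
have Phi0 : 0 <= Phi by apply: rsum_ge0 => s; left; apply: exp_pos.
have c0 : 0 <= 24 * mu * theta ^ 2 * Phi.
  by have := mean_ge0; have := pow2_ge_0 theta => *; apply: Rmult_le_pos => //; nra.
have [|A_pos] := Rle_or_lt (theta * A) 0; first by lra.
have : (theta * A) * (6 * theta) <= (theta * A) * / 2 by apply: Rmult_le_compat_l; lra.
by move: bnd c0 => /=; lra.
Qed.

(** Along the ray [u theta], the moment generating function times the integrating factor
    [exp (- 12 mu theta^2 u^2)] has nonpositive derivative by [stein_drift]; the mean value theorem
    compares [u = 1] with [u = 0]. *)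
Lemma mgf_bound theta : theta <= / 12 ->
  \rsum_s exp (theta * (X s - mu)) <= INR #|{perm 'I_n}| * exp (12 * mu * theta ^ 2).
Proof.
move=> le12.
pose e (s : {perm 'I_n}) u := u * (theta * (X s - mu)) + - (12 * mu * theta ^ 2) * u ^ 2.
pose h u := \rsum_s exp (e s u).
pose dh u := \rsum_s (exp (e s u) * (theta * (X s - mu) - 24 * mu * theta ^ 2 * u)).
have hE u : derivable_pt_lim h u (dh u).
  apply: derivable_rsum => s; apply: (derivable_pt_lim_comp (e s) exp).
    have -> : theta * (X s - mu) - 24 * mu * theta ^ 2 * u =
       (1 * (theta * (X s - mu)) + u * 0) + - (12 * mu * theta ^ 2) * (INR 2 * u ^ 1).
      by rewrite /=; ring.
    apply: derivable_pt_lim_plus.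
      apply: (derivable_pt_lim_mult id (fct_cte _)); first exact: derivable_pt_lim_id.
      exact: derivable_pt_lim_const.
    exact: (derivable_pt_lim_scal (fun u => u ^ 2) _ u _ (derivable_pt_lim_pow u 2)).
  exact: derivable_pt_lim_exp.
have [c [hc [c0 c1]]] := MVT_cor2 h dh 0 1 Rlt_0_1 (fun c _ => hE c).
have dhc : dh c <= 0.
  have le_ct : c * theta <= / 12 by have [|] := Rle_or_lt 0 theta; nra.
  have := stein_drift le_ct.
  (* [K] undoes the centring and the integrating factor, so the drift inequality at [c theta]
     becomes [c K dh c <= 0]. *)
  pose K := exp (c * theta * mu + 12 * mu * theta ^ 2 * c ^ 2).
  have K0 : 0 < K := exp_pos _.
  have -> : c * theta * \rsum_s ((X s - mu) * exp (c * theta * X s)) =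
    24 * mu * (c * theta) ^ 2 * \rsum_s exp (c * theta * X s)
    + c * K * dh c.
    rewrite /dh -!rsumZ -rsumD; apply: eq_bigr => s _.
    have -> : exp (c * theta * X s) = K * exp (e s c).
      by rewrite -exp_plus; congr exp; rewrite /e; ring.
    by ring.
  by move=> ?; have cK : 0 < c * K by [nra]; nra.
have h0 : h 0 = INR #|{perm 'I_n}|.
  rewrite -[RHS]Rmult_1_r -rsum_const; apply: eq_bigr => s _.
  by rewrite -exp_0; congr exp; rewrite /e; ring.
have h1 : \rsum_s exp (theta * (X s - mu)) = exp (12 * mu * theta ^ 2) * h 1.
  by rewrite /h -rsumZ; apply: eq_bigr => s _; rewrite -exp_plus; congr exp; rewrite /e; ring.
have : h 1 <= INR #|{perm 'I_n}| by nra.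
by rewrite h1 => ?; have := exp_pos (12 * mu * theta ^ 2); nra.
Qed.

(** Markov's inequality; the sign of [theta] selects the tail. *)
Lemma chernoff (P : pred {perm 'I_n}) theta r : theta <= / 12 ->
  (forall s, P s -> r <= theta * (X s - mu)) ->
  INR #|P| <= INR #|{perm 'I_n}| * exp (12 * mu * theta ^ 2 - r).
Proof.
move=> le12 leP.
have : exp r * INR #|P| <= \rsum_s exp (theta * (X s - mu)).
  rewrite -sum1_card INR_sum big_mkcond -rsumZ; apply: rsum_le => s.
  have := exp_pos (theta * (X s - mu)); rewrite unfold_in; case: ifP => [Ps _|_]; last by lra.
  by rewrite /= Rmult_1_r; apply/exp_le_compat/leP.
move/Rle_trans/(_ (mgf_bound le12)); have e0 := exp_pos r.
have -> : exp (12 * mu * theta ^ 2) = exp (12 * mu * theta ^ 2 - r) * exp r.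
  by rewrite -exp_plus; congr exp; ring.
by move=> ?; apply: (Rmult_le_reg_l (exp r)); lra.
Qed.

Lemma lower_tail (P : pred {perm 'I_n}) t q : 0 < t -> 48 * q * mu <= t ^ 2 ->
  (forall s, P s -> X s <= mu - t) ->
  INR #|P| <= INR #|{perm 'I_n}| * exp (- q).
Proof.
move=> t0 le_t leP; have [mu0|mu0] := mean_ge0; last first.
  (* For [mu = 0] the event is empty, as weights are nonnegative. *)
  rewrite (eq_card0 (A := P)) => [|s].
    by have := exp_pos (- q); have := pos_INR #|{perm 'I_n}|; rewrite /=; nra.
  rewrite inE; apply/negP => /leP; have := cycle_weight_ge0 s; lra.
(* The minimizer of [12 mu c^2 - c t]. *)
pose c := t / (24 * mu).
have c0 : 0 < c by apply: Rdiv_lt_0_compat; lra.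
have cE : 12 * mu * (- c) ^ 2 - c * t = - (t ^ 2 / (48 * mu)).
  by rewrite /c; field; lra.
have le_q : q <= t ^ 2 / (48 * mu) by apply: le_div; lra.
have := @chernoff P (- c) (c * t); rewrite cE => chern.
apply: Rle_trans (chern _ _) _; first lra.
  by move=> s /leP ?; nra.
by apply: Rmult_le_compat_l; [apply: pos_INR | apply: exp_le_compat; lra].
Qed.

Lemma upper_tail (P : pred {perm 'I_n}) t q : 0 < t -> 48 * q * mu <= t ^ 2 -> 24 * q <= t ->
  (forall s, P s -> mu + t <= X s) ->
  INR #|P| <= INR #|{perm 'I_n}| * exp (- q).
Proof.
move=> t0 le_t le_t' leP.
(* The minimizer [t / (24 mu)] is admissible only for [t <= 2 mu]. Beyond that, [c = 1/12] gives the
   exponent [(mu - t) / 12 < - t / 24 <= - q]. *)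
have [c [c0 c12 le_q]] : exists c, [/\ 0 < c, c <= / 12 & 12 * mu * c ^ 2 - c * t <= - q].
  have mu0 := mean_ge0.
  have [le2|lt2] := Rle_or_lt t (2 * mu); last first.
    by exists (/ 12); split; [lra | lra | rewrite /=; lra].
  have mu1 : 0 < mu by lra.
  exists (t / (24 * mu)); split; first by apply: Rdiv_lt_0_compat; lra.
    by apply: (Rmult_le_reg_r (24 * mu)); [lra | field_simplify; lra].
  have -> : 12 * mu * (t / (24 * mu)) ^ 2 - t / (24 * mu) * t = - (t ^ 2 / (48 * mu)).
    by field; lra.
  by apply: Ropp_le_contravar; apply: le_div; lra.
apply: Rle_trans (chernoff (r := c * t) c12 _) _; first by move=> s /leP ?; nra.
by apply: Rmult_le_compat_l; [apply: pos_INR | apply: exp_le_compat; lra].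
Qed.

End Concentration.

(** * From permutations to Hamilton cycles, and weights as cycle weights *)

Section HamiltonCycles.
Variable n : nat.
Hypothesis n_gt6 : (6 < n)%N.

Definition cycle_of (s : {perm 'I_n}) : {set {set 'I_n}} :=
  [set [set s i; s (ordS i)] | i : 'I_n].

Lemma cycle_ofM s t : cycle_of (s * t)%g = [set t @: e | e : {set 'I_n} in cycle_of s].
Proof.
rewrite /cycle_of -imset_comp; apply: eq_imset => i /=.
by rewrite imsetU1 imset_set1 !permM.
Qed.

(* Relabelling the vertices acts transitively on Hamilton cycles, so all fibres
   of [cycle_of] have the same size. *)
Lemma card_cycle_fibre s0 :
  #|[set s | cycle_of s == cycle_of s0]| = #|[set s | cycle_of s == cycle_of 1%g]|.
Proof.
rewrite -(card_imset _ (@mulIg _ s0^-1%g)); apply: eq_card => s.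
rewrite inE; apply/imsetP/eqP => [[t + ->]|E].
  by rewrite inE => /eqP E; rewrite cycle_ofM E -cycle_ofM mulgV.
exists (s * s0)%g; last by rewrite mulgK.
by rewrite inE cycle_ofM E -cycle_ofM mul1g.
Qed.

Lemma card_cycle_of (P : pred {set {set 'I_n}}) :
  #|[pred s | P (cycle_of s)]| =
  (#|[set H in ham_cycles n | P H]| * #|[set s | cycle_of s == cycle_of 1%g]|)%N.
Proof.
rewrite -[LHS]sum1_card (partition_big cycle_of [in [set H in ham_cycles n | P H]]) /=.
  rewrite -sum_nat_const; apply: eq_bigr => H; rewrite !inE => /andP[/existsP[s0 /eqP ->] PH].
  rewrite -(card_cycle_fibre s0) -sum1_card; apply: eq_bigl => s.
  by rewrite !inE; case: eqP => [->|_]; rewrite ?andbF ?andbT //.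
move=> s Ps; rewrite !inE; apply/andP; split; last exact: Ps.
by apply/existsP; exists s.
Qed.

(** The common fibre size of [cycle_of] cancels from numerator and denominator. *)
Lemma ham_cycle_proportion (P : pred {set {set 'I_n}}) c :
  INR #|[pred s | P (cycle_of s)]| <= INR #|{perm 'I_n}| * c ->
  INR #|[set H in ham_cycles n | P H]| / INR #|ham_cycles n| <= c.
Proof.
have -> : #|{perm 'I_n}| = #|[pred s | xpredT (cycle_of s)]| by apply: eq_card.
have ham : #|[set H in ham_cycles n | xpredT H]| = #|ham_cycles n|.
  by apply: eq_card => H; rewrite !inE andbT.
rewrite (card_cycle_of P) (card_cycle_of xpredT) ham !mult_INR.
set k := #|[set s | cycle_of s == cycle_of 1%g]|; set h := #|ham_cycles n| => le_c.
have k0 : 0 < INR k.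
  by apply/lt_0_INR/ltP/card_gt0P; exists 1%g; rewrite inE.
have h0 : 0 < INR h.
  apply/lt_0_INR/ltP/card_gt0P; exists (cycle_of 1%g).
  by rewrite inE; apply/existsP; exists 1%g.
apply: (Rmult_le_reg_r (INR h)) => //; apply: (Rmult_le_reg_r (INR k)) => //.
by field_simplify; lra.
Qed.

Lemma ordSS_neq (i : 'I_n) : ordS (ordS i) != i.
Proof.
apply/eqP => /(congr1 val) /= E.
have : (i + 2 == i + 0 %[mod n])%N.
  rewrite addn0 (modn_small (ltn_ord i)) -[X in _ == X]E.
  by rewrite -[X in _ == X %% n]addn1 modnDml addn1 addn2.
by rewrite eqn_modDl mod0n modn_small // (ltn_trans _ n_gt6).
Qed.

(** Two distinct positions tracing one edge would each be the successor of the other, against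
    [ordSS_neq]. Hence summing over positions counts each edge of the cycle once. *)
Lemma cycle_edge_inj (s : {perm 'I_n}) : injective (fun i => [set s i; s (ordS i)]).
Proof.
move=> i j E.
have: s i \in [set s j; s (ordS j)] by rewrite -E set21.
have: s j \in [set s i; s (ordS i)] by rewrite E set21.
rewrite !inE !(inj_eq perm_inj) => /orP[/eqP // | /eqP Ej] /orP[/eqP // | /eqP Ei].
by have := ordSS_neq i; rewrite -Ej -Ei eqxx.
Qed.

Section Weights.
Variable w : {set 'I_n} -> bool.

(** The diagonal is set to 0 because [w] is arbitrary on the singleton [[set x; x]]. *)
Definition edge_weight (x y : 'I_n) : R := if x == y then 0 else INR (w [set x; y]).

Lemma edge_weight_sym x y : edge_weight x y = edge_weight y x.
Proof. by rewrite /edge_weight eq_sym setUC. Qed.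

Lemma edge_weight_diag x : edge_weight x x = 0.
Proof. by rewrite /edge_weight eqxx. Qed.

Lemma edge_weight01 x y : 0 <= edge_weight x y <= 1.
Proof.
rewrite /edge_weight; case: (x == y); first lra.
case: (w _) => /=; lra.
Qed.

Lemma cycle_weightE s : cycle_weight edge_weight s = INR (wt w (cycle_of s)).
Proof.
rewrite /wt big_imset /=; last by move=> i j _ _; apply: cycle_edge_inj.
rewrite INR_sum; apply: eq_bigr => k _.
by rewrite /edge_weight (inj_eq perm_inj) (negbTE (ordS_neq n_gt6 k)).
Qed.

Lemma total_weightE : total_weight edge_weight = 2 * INR (wt w (edges_Kn n)).
Proof.
rewrite /total_weight pair_bigA /=.
pose pr (p : 'I_n * 'I_n) := [set p.1; p.2].
transitivity (INR (\sum_(p | p.1 != p.2) w (pr p))%N).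
  rewrite INR_sum [RHS]big_mkcond; apply: eq_bigr => p _.
  by rewrite /edge_weight; case: eqP.
rewrite -(mult_INR 2); congr INR; rewrite multE /wt big_distrr /=.
rewrite (partition_big pr [in edges_Kn n]) /=; last first.
  by move=> p ne_p; rewrite inE cards2 ne_p.
apply: eq_bigr => e; rewrite inE => /cards2P[x [y [ne_xy ->]]].
rewrite (eq_bigr (fun=> nat_of_bool (w [set x; y]))); last by move=> p /andP[_ /eqP->].
rewrite sum_nat_const; congr (_ * _)%N.
transitivity #|[set (x, y); (y, x)]|; last first.
  by rewrite cards2 xpair_eqE (negbTE ne_xy).
apply: eq_card => -[u v]; rewrite !inE unfold_in /= !xpair_eqE.
apply/idP/idP => [/andP[ne_uv /eqP E]|]; last first.
  by case/orP => /andP[/eqP-> /eqP->]; rewrite ?ne_xy ?(eq_sym y) ?ne_xy /pr /= ?(setUC [set y]) eqxx.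
have: u \in [set x; y] by rewrite -E set21.
have: v \in [set x; y] by rewrite -E set22.
rewrite !inE => /orP[]/eqP Ev /orP[]/eqP Eu; subst; rewrite ?eqxx ?orbT //.
all: by rewrite eqxx in ne_uv.
Qed.

End Weights.

(** Complementing [w] reflects the weight, turning a lower tail at mean [d n] into an upper tail at
    mean [(1 - d) n]. *)
Lemma cycle_weight_compl w s :
  cycle_weight (edge_weight (fun e => ~~ w e)) s = INR n - cycle_weight (edge_weight w) s.
Proof.
have -> : INR n = \big[Rplus/0]_(k < n) 1 by rewrite rsum_const card_ord; ring.
rewrite -rsumB; apply: eq_bigr => k _.
rewrite /edge_weight (inj_eq perm_inj) (negbTE (ordS_neq n_gt6 k)).
by case: (w _) => /=; ring.
Qed.

Lemma total_weight_compl w :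
  total_weight (edge_weight (fun e => ~~ w e)) =
  INR n * (INR n - 1) - total_weight (edge_weight w).
Proof.
have -> : INR n * (INR n - 1) = \big[Rplus/0]_(x < n) \big[Rplus/0]_(y < n) (1 - kron x y).
  rewrite (eq_bigr (fun=> INR n - 1)) ?rsum_const ?card_ord //.
  move=> x _; rewrite rsumB rsum_const card_ord Rmult_1_r; congr (_ - _).
  rewrite -[RHS](rsum_kron x (fun=> 1)); apply: eq_bigr => y _.
  by rewrite /kron eq_sym; case: (_ == _); ring.
rewrite -rsumB; apply: eq_bigr => x _; rewrite -rsumB; apply: eq_bigr => y _.
by rewrite /edge_weight /kron; case: (x == y); [ring | case: (w _) => /=; ring].
Qed.

End HamiltonCycles.

(** * Numerical estimates *)

Lemma INR_bin2 n : INR 'C(n, 2) = INR n * (INR n - 1) / 2.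
Proof.
case: n => [|n]; first by rewrite /=; lra.
have /(congr1 INR) := mul_bin_diag n.+1 1.
by rewrite bin1 -pred_Sn !mult_INR (S_INR n) [INR 2]/=; lra.
Qed.

(** Here [exp (- q)] is the target probability, and [q > 1] because [exp (/ eps) < n]. The three
    bounds serve to absorb [rho n] and to meet the linear and quadratic conditions of the tail
    lemmas. *)
Lemma m_eps_lower n d eps : 0 <= d <= 1 -> 0 < eps -> 6 < INR n -> exp (/ eps) < INR n ->
  let q := eps * ln (INR n) in
  [/\ 40 <= m_eps eps n d, 40 * q <= m_eps eps n d
    & 1600 * q * (d * INR n) <= m_eps eps n d ^ 2].
Proof.
move=> d01 e0 n6 en q.
have L0 : / eps < ln (INR n) by rewrite -[X in X < _]ln_exp; apply: ln_increasing => //; apply: exp_pos.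
have ie0 := Rinv_0_lt_compat _ e0.
have q1 : 1 < q.
  by have := Rmult_lt_compat_l _ _ _ e0 L0; rewrite Rinv_r /q; lra.
set L := ln (INR n) in L0 q q1 *.
have se := sqrt_pos eps; have sse := sqrt_sqrt eps (Rlt_le _ _ e0).
pose A := sqrt eps * sqrt (sqrt d) * sqrt (INR n * L).
have A0 : 0 <= A by repeat apply: Rmult_le_pos; apply: sqrt_pos.
have sqA : A ^ 2 = q * (sqrt d * INR n).
  have -> : A ^ 2 = (sqrt eps * sqrt eps) * (sqrt (sqrt d) * sqrt (sqrt d))
     * (sqrt (INR n * L) * sqrt (INR n * L)) by rewrite /A; ring.
  rewrite !sqrt_sqrt; [by rewrite /q; ring | nra | exact: sqrt_pos | lra].
(* The factor [d^(1/4)] squares to [sqrt d], which dominates [d] on [0,1]. *)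
have le_d : d <= sqrt d.
  have := sqrt_sqrt d (proj1 d01); have := sqrt_pos d.
  by have : sqrt d <= 1 by [rewrite -sqrt_1; apply: sqrt_le_1_alt; lra]; nra.
have -> : m_eps eps n d = 40 * (q + sqrt eps * L) + 40 * A by rewrite /m_eps /A /q /L; ring.
have B0 : 0 <= sqrt eps * L by apply: Rmult_le_pos; lra.
split; [lra | lra |].
apply: (Rle_trans _ (1600 * A ^ 2)); last by nra.
rewrite sqA; have : d * INR n <= sqrt d * INR n by nra.
by nra.
Qed.

Theorem theorem5p4 (n : nat) (d eps : R) (w : {set 'I_n} -> bool)
  (Hreg : regular_instance d eps w)
  (Mstar : {set {set 'I_n}})
  (HMopt : optimal_matching Mstar)
  (HMmin : forall M : {set {set 'I_n}}, optimal_matching M -> (wt w Mstar <= wt w M)%N)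
  (Hstar : {set {set 'I_n}})
  (HHam : is_ham_cycle Hstar)
  (HHw : INR (wt w Hstar) <=
         (1 - / (INR n - 2)) * INR (wt w Mstar)
         + / (INR n - 2) * INR (wt w (edges_Kn n)) + rho n) :
  INR #|[set H in ham_cycles n | (wt w H <= wt w Hstar)%N]|
    / INR #|ham_cycles n|
  <= 2 * Rpower (INR n) (- eps).
Proof.
have [d01 [e0 [n6 [en [wK [M [Mopt Mle]]]]]]] := Hreg.
have n_gt6 : (6 < n)%N by apply/ltP/INR_lt; rewrite /=; lra.
have n7 : 7 <= INR n by have /leP/le_INR := n_gt6; rewrite /=; lra.
have pow0 : 0 < Rpower (INR n) (- eps) := exp_pos _.
apply: (Rle_trans _ (Rpower (INR n) (- eps))); last by lra.
rewrite /Rpower Ropp_mult_distr_l_reverse.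
have Mstar_le : INR (wt w Mstar) <= INR (wt w M) by apply/le_INR/leP/HMmin.
pose mu := d * INR n.
have total_mu : total_weight (edge_weight w) = (INR n - 1) * mu.
  by rewrite total_weightE wK INR_bin2 /mu; field.
have rho1 : rho n <= 1 by rewrite /rho; case: (odd n); lra.
(* [31 / 40] absorbs the factor [1 - 1 / (n - 2) >= 4 / 5] and the additive
   [rho n <= m / 40]. *)
have Hstar_le m : 40 <= m -> INR (wt w M) <= / 2 * d * INR n - m ->
    INR (wt w Hstar) <= mu - 31 / 40 * m.
  move=> m40 Mm; pose r := / (INR n - 2).
  have r5 : r <= / 5 by apply: Rinv_le_contravar; lra.
  have rE : r * (INR n - 2) = 1 by rewrite /r Rinv_l; lra.
  have : (1 - r) * INR (wt w Mstar) <= (1 - r) * (/ 2 * d * INR n - m).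
    by apply: Rmult_le_compat_l; lra.
  (* The main terms [(1 - r) d n / 2] and [(1 + r) d n / 2] add up to the mean [d n]. *)
  have : r * INR (wt w (edges_Kn n)) = / 2 * d * INR n * (1 + r).
    rewrite wK INR_bin2.
    have -> : r * (d * (INR n * (INR n - 1) / 2)) =
      / 2 * d * INR n * (r * (INR n - 2) + r) by field.
    by rewrite rE.
  move: HHw; rewrite -/r /mu => ? ? ?.
  have : r * m <= / 5 * m by apply: Rmult_le_compat_r; lra.
  by nra.
set q := eps * ln (INR n) in pow0 *.
apply: (@ham_cycle_proportion n (fun H => wt w H <= wt w Hstar)%N).
case: Mle => /Hstar_le bnd.
- have [m40 mq mq2] := m_eps_lower d01 e0 n6 en.
  have {}bnd := bnd m40.
  apply: (lower_tail n_gt6 (edge_weight_sym w) (edge_weight_diag w) (edge_weight01 w)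
          total_mu (t := 31 / 40 * m_eps eps n d)); first lra.
    (* Here [(31/40)^2 * 1600 = 961], well above 48. *)
    by rewrite -/q -/mu in mq2 *; nra.
  by move=> s /leP/le_INR; rewrite cycle_weightE //; lra.
- have d01' : 0 <= 1 - d <= 1 by lra.
  have [m40 mq mq2] := m_eps_lower d01' e0 n6 en.
  have {}bnd := bnd m40.
  pose w' e := ~~ w e.
  have total' : total_weight (edge_weight w') = (INR n - 1) * ((1 - d) * INR n).
    by rewrite total_weight_compl total_mu /mu; ring.
  apply: (upper_tail n_gt6 (edge_weight_sym w') (edge_weight_diag w') (edge_weight01 w')
          total' (t := 31 / 40 * m_eps eps n (1 - d))); first lra.
  + by rewrite -/q in mq2 *; nra.
  (* Here [31/40 * 40 q = 31 q >= 24 q]. *)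
  + by rewrite -/q in mq *; lra.
  + move=> s /leP/le_INR; rewrite cycle_weight_compl // cycle_weightE //.
    by move: bnd; rewrite /mu; lra.
Qed.
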